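(* Let $\mathbb{F}$ be a field with $\operatorname{char}\mathbb{F}\neq 2$, and let $L$ be a finite-dimensional 2-step nilpotent Lie superalgebra over $\mathbb{F}$. Then $L$ admits pure local superderivations, i.e. there exists a local superderivation of $L$ that is not a superderivation of $L$.
   Context: A Lie superalgebra over $\mathbb{F}$ is a $\mathbb{Z}_2$-graded vector space $L=L_{\bar 0}\oplus L_{\bar 1}$ with a bilinear bracket satisfying $[L_\alpha,L_\beta]\subseteq L_{\alpha+\beta}$ and, for all $x\in L_\alpha$, $y\in L_\beta$, $z\in L$ with $\alpha,\beta\in\mathbb{Z}_2$ (in the first identity $x,y$ are homogeneous of degrees $|x|=\alpha$, $|y|=\beta$), $[x,y]=-(-1)^{|x||y|}[y,x]$ and $[x,[y,z]]=[[x,y],z]+(-1)^{|x||y|}[y,[x,z]]$. Lower central series: $L^0=L$, $L^1=[L,L]$, $L^k=[L,L^{k-1}]$ for $k\geq 1$. $L$ is nilpotent if $L^n=0$ for some positive integer $n$; the smallest such positive integer $n$ is the nilpotency index, and $L$ is then called $n$-step nilpotent. (So 2-step nilpotent means $L^1\neq 0$ and $L^2=0$.) A linear map $D:L\to L$ that is homogeneous of degree $|D|=\alpha\in\mathbb{Z}_2$ (i.e. $D(L_\beta)\subseteq L_{\alpha+\beta}$) is a superderivation of degree $\alpha$ if $D([x,y])=[D(x),y]+(-1)^{|D||x|}[x,D(y)]$ for all homogeneous $x\in L$ and all $y\in L$. Let $\operatorname{Der}_\alpha(L)$ be the set of these, and $\operatorname{Der}(L)=\operatorname{Der}_{\bar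 0}(L)\oplus\operatorname{Der}_{\bar 1}(L)$; the elements of $\operatorname{Der}(L)$ are the superderivations of $L$. A linear map $\Delta:L\to L$ is a local superderivation if for every $x\in L$ there is a superderivation $D_x\in\operatorname{Der}(L)$ (depending on $x$) with $\Delta(x)=D_x(x)$. A pure local superderivation is a local superderivation that is not a superderivation. *)

(* Defs.v *)
From HB Require Import structures.
From mathcomp Require Import all_boot all_order all_algebra.

Set Implicit Arguments.
Unset Strict Implicit.
Unset Printing Implicit Defensive.

Import GRing.Theory.
Local Open Scope ring_scope.

(* Finite dimensionality is part of [vectType].  In the signs, elements of 'Z_2
   are coerced to their representatives 0, 1 : nat. *)
Record lieSuperalgebra (F : fieldType) (L : vectType F) := LieSuperalgebra {
  part : 'Z_2 -> {vspace L};
  bracket : {bilinear L -> L -> L};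
  part_direct : directv (part 0%R + part 1%R);
  part_full : (part 0%R + part 1%R)%VS = fullv;
  bracket_part : forall (a b : 'Z_2) (x y : L),
    x \in part a -> y \in part b -> bracket x y \in part (a + b);
  bracket_skew : forall (a b : 'Z_2) (x y : L),
    x \in part a -> y \in part b ->
    bracket x y = - ((-1) ^+ (a * b)%N *: bracket y x);
  bracket_jacobi : forall (a b : 'Z_2) (x y z : L),
    x \in part a -> y \in part b ->
    bracket x (bracket y z) =
      bracket (bracket x y) z + (-1) ^+ (a * b)%N *: bracket y (bracket x z)
}.

Section Definitions.

Variables (F : fieldType) (L : vectType F) (G : lieSuperalgebra L).
Implicit Types (U V W : {vspace L}) (D : 'End(L)).

(* The span of all [u, v] with u in U and v in V (see [bracketvP]), computed
   on bases as [prodv] is for algebras. *)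
Definition bracketv U V : {vspace L} :=
  <<[seq bracket G u v | u <- vbasis U, v <- vbasis V]>>%VS.

Lemma memv_bracket U V :
  {in U & V, forall u v, bracket G u v \in bracketv U V}.
Proof.
move=> u v /coord_vbasis-> /coord_vbasis->.
rewrite linear_sumlz; apply: memv_suml => i _.
rewrite linear_sumr; apply: memv_suml => j _.
rewrite linearZl_LR linearZr_LR !memvZ // memv_span //.
by apply/allpairsP; exists ((vbasis U)`_i, (vbasis V)`_j); rewrite !memt_nth.
Qed.

Lemma bracketvP U V W :
  reflect {in U & V, forall u v, bracket G u v \in W} (bracketv U V <= W)%VS.
Proof.
apply: (iffP idP) => [sUVW u v Uu Vv | sUVW].
  by rewrite (subvP sUVW) ?memv_bracket.
apply/span_subvP=> _ /allpairsP[[u v] /= [Uu Vv ->]].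
by rewrite sUVW ?vbasis_mem.
Qed.

Fixpoint lower_central (k : nat) : {vspace L} :=
  if k is k'.+1 then bracketv fullv (lower_central k') else fullv.

Definition step_nilpotent (n : nat) : Prop :=
  [/\ (0 < n)%N, lower_central n = 0%VS
    & forall m : nat, (0 < m < n)%N -> lower_central m <> 0%VS].

Definition superderivation_of_degree (a : 'Z_2) D : Prop :=
  (forall (b : 'Z_2) (x : L), x \in part G b -> D x \in part G (a + b)) /\
  (forall (b : 'Z_2) (x y : L), x \in part G b ->
     D (bracket G x y) =
       bracket G (D x) y + (-1) ^+ (a * b)%N *: bracket G x (D y)).

Definition superderivation D : Prop :=
  exists D0 D1 : 'End(L),
    [/\ superderivation_of_degree 0 D0, superderivation_of_degree 1 D1
      & D = D0 + D1].

Definition local_superderivation (Delta : 'End(L)) : Prop :=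
  forall x : L, exists2 D : 'End(L), superderivation D & Delta x = D x.

Definition pure_local_superderivation (Delta : 'End(L)) : Prop :=
  local_superderivation Delta /\ ~ superderivation Delta.

End Definitions.

(* Main.v *)
From HB Require Import structures.
Require Import Defs.
From mathcomp Require Import all_boot all_order all_algebra.

(** Let C = [L, L], which is graded and central, and let Delta be an even
    projection of L onto C.  Delta is not a superderivation: it fixes a nonzero
    bracket [x, y], while [Delta x, y] and [x, Delta y] vanish.  It is a local
    one: on C it agrees with (1 + Delta) / 2, and at x outside C it agrees with
    a linear map that kills C and takes values in C, since x - Delta x <> 0 may
    be sent to Delta x; both maps are superderivations. *)

Set Implicit Arguments.
Unset Strict Implicit.
Unset Printing Implicit Defensive.

Import GRing.Theory.
Local Open Scope ring_scope.

Lemma Z2P (a : 'Z_2) : a = 0 \/ a = 1.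
Proof. by case: a => [[|[|?]] ?] //; [left | right]; apply: val_inj. Qed.

Lemma Z2_addrr (a : 'Z_2) : a + a = 0.
Proof. by case: (Z2P a) => ->; apply: val_inj. Qed.

(** The map is [y |-> c(y) u], with [c] the coordinate functional of the free family [[:: v]]: it is
    linear on all of [L] and [c(v) = 1]. *)
Lemma exists_endo_sending (F : fieldType) (L : vectType F) (v u : L) :
  v != 0 -> exists g : 'End(L), g v = u.
Proof.
move=> v0; pose X := [tuple of [:: v]].
have freeX : free X by rewrite seq1_free.
have lin : linear (fun y => coord X ord0 y *: u).
  by move=> k y z; rewrite linearP scalerDl scalerA.
pose h := GRing.isLinear.Build F L L *:%R (fun y => coord X ord0 y *: u) lin.
pose f : {linear L -> L} := HB.pack (fun y => coord X ord0 y *: u) h.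
exists (linfun f); rewrite lfunE /=.
by have := coord_free ord0 ord0 freeX; rewrite /= => ->; rewrite scale1r.
Qed.

Section LieSuperalgebra.

Variables (F : fieldType) (L : vectType F) (G : lieSuperalgebra L).
Implicit Types (a b : 'Z_2) (x y w : L) (D : 'End(L)).

(** In ['Z_2] the other part has degree [a + 1], so one definition serves both parities. *)
Definition part_proj a : 'End(L) := daddv_pi (part G a) (part G (a + 1)%R).

Lemma part_direct_succ a : (part G a :&: part G (a + 1)%R = 0)%VS.
Proof.
have /directv_addP d := part_direct G.
case: (Z2P a) => ->; first by rewrite add0r.
by rewrite Z2_addrr capvC.
Qed.

Lemma part_full_succ a : (part G a + part G (a + 1)%R)%VS = fullv.
Proof.
case: (Z2P a) => ->; first by rewrite add0r part_full.
by rewrite Z2_addrr addvC part_full.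
Qed.

Lemma part_projP a x : part_proj a x \in part G a.
Proof. exact: memv_pi. Qed.

Lemma part_proj_id a x : x \in part G a -> part_proj a x = x.
Proof. by move=> xa; rewrite /part_proj daddv_pi_id ?part_direct_succ. Qed.

Lemma part_proj_sum a x : part_proj a x + part_proj (a + 1) x = x.
Proof.
rewrite /part_proj -addrA Z2_addrr addr0.
by rewrite daddv_pi_add ?part_direct_succ // part_full_succ memvf.
Qed.

Lemma part_proj_sum01 x : part_proj 0 x + part_proj 1 x = x.
Proof. by have := part_proj_sum 0 x; rewrite add0r. Qed.

Lemma part_proj_other a x : x \in part G a -> part_proj (a + 1) x = 0.
Proof.
move=> xa; apply: (addrI (part_proj a x)).
by rewrite part_proj_sum part_proj_id ?addr0.
Qed.

Lemma part_eq0 a x : x \in part G a -> x \in part G (a + 1) -> x = 0.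
Proof. by move=> xa /part_proj_id <-; apply: part_proj_other. Qed.

(** The sign rules are stated on homogeneous elements; additive claims reduce to these. *)
Lemma part_ind (P : L -> Prop) :
  (forall x y, P x -> P y -> P (x + y)) ->
  (forall a x, x \in part G a -> P x) -> forall x, P x.
Proof.
move=> PD Ppart x; rewrite -(part_proj_sum01 x).
by apply: PD; apply: Ppart; apply: part_projP.
Qed.

(** A bracket of homogeneous elements is homogeneous, so [part_proj a] either fixes or kills it;
    hence [[L, L]] is graded. *)
Lemma part_proj_bracketv a w :
  w \in bracketv G fullv fullv -> part_proj a w \in bracketv G fullv fullv.
Proof.
set C := bracketv _ _ _ => Cw.
(* Stated as inclusion in a preimage, the claim need only be checked on brackets. *)
suff /subvP/(_ w Cw) : (C <= part_proj a @^-1: C)%VS by rewrite memv_preim.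
apply/bracketvP => x y _ _; rewrite -memv_preim.
elim/part_ind: x => [x1 x2 IH1 IH2|b x xb].
  by rewrite linearDl linearD memvD.
elim/part_ind: y => [y1 y2 IH1 IH2|c y yc].
  by rewrite linearDr linearD memvD.
have xy := bracket_part xb yc.
have [<-|/eqP ne] := eqVneq (b + c) a.
  by rewrite part_proj_id // memv_bracket ?memvf.
have -> : a = b + c + 1.
  by move: ne; case: (Z2P (b + c)) => ->; case: (Z2P a) => -> // _;
    apply: val_inj.
by rewrite part_proj_other // mem0v.
Qed.

(* On each part any projection onto [C :&: part a] serves: only the values on
   [part a] matter, so no graded complement of [C] has to be chosen. *)
Definition graded_proj (C : {vspace L}) : 'End(L) :=
  (projv (C :&: part G 0%R) \o part_proj 0)%VF +
  (projv (C :&: part G 1%R) \o part_proj 1)%VF.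

Lemma graded_projE C x :
  graded_proj C x = projv (C :&: part G 0%R) (part_proj 0 x) +
                    projv (C :&: part G 1%R) (part_proj 1 x).
Proof. by rewrite add_lfunE !comp_lfunE. Qed.

Lemma graded_proj_mem (C : {vspace L}) x : graded_proj C x \in C.
Proof.
rewrite graded_projE; apply: memvD; apply: (subvP (capvSl C (part G _)));
  exact: memv_proj.
Qed.

Lemma graded_proj_part C a x : x \in part G a -> graded_proj C x \in part G a.
Proof.
rewrite graded_projE => xa.
have other := part_proj_other xa.
case: (Z2P a) xa other => -> xa; rewrite ?add0r ?Z2_addrr => ->;
  rewrite linear0 ?addr0 ?add0r; apply: (subvP (capvSr C _)); exact: memv_proj.
Qed.

Lemma graded_proj_id (C : {vspace L}) w :
  (forall a, part_proj a w \in C) -> graded_proj C w = w.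
Proof.
move=> Cw; have CPw a : part_proj a w \in (C :&: part G a)%VS.
  by rewrite memv_cap Cw part_projP.
by rewrite graded_projE (projv_id (CPw 0)) (projv_id (CPw 1)) part_proj_sum01.
Qed.

Section Central.

Variable C : {vspace L}.
Hypothesis bracketC : forall x y, bracket G x y \in C.
Hypothesis centralC : forall w x, w \in C -> bracket G x w = 0.
Hypothesis gradedC : forall a w, w \in C -> part_proj a w \in C.

(** Skew-symmetry takes homogeneous arguments, so [w] is split into its components, which stay in
    [C] because [C] is graded. *)
Lemma central_bracketl w x : w \in C -> bracket G w x = 0.
Proof.
move=> Cw; elim/part_ind: x => [x y Hx Hy|b x xb].
  by rewrite linearDr /= Hx Hy addr0.
rewrite -(part_proj_sum01 w) linearDl /=.
by rewrite !(bracket_skew (part_projP _ w) xb) !(centralC _ (gradedC _ Cw))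
  !scaler0 oppr0 addr0.
Qed.

(** Both sides of the Leibniz rule vanish: [D] kills brackets, and its values are central. *)
Lemma central_superderivation_of_degree a D :
  (forall b x, x \in part G b -> D x \in part G (a + b)) ->
  (forall x, D x \in C) -> (forall w, w \in C -> D w = 0) ->
  superderivation_of_degree G a D.
Proof.
move=> Dpart DC D0; split=> // b x y xb.
by rewrite D0 // central_bracketl // centralC // scaler0 addr0.
Qed.

Lemma central_superderivation D :
  (forall x, D x \in C) -> (forall w, w \in C -> D w = 0) ->
  superderivation G D.
Proof.
move=> DC D0.
(* [hom a] is the degree [a] component of [D], made of its blocks from part [b] to part [a + b]. As
   [C] is graded, [hom a] still kills [C] and takes values in [C]. *)
pose hom a : 'End(L) := (part_proj a \o D \o part_proj 0)%VF +
    (part_proj (a + 1) \o D \o part_proj 1)%VF.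
have homE a x : hom a x =
    part_proj a (D (part_proj 0 x)) + part_proj (a + 1) (D (part_proj 1 x)).
  by rewrite add_lfunE !comp_lfunE.
have homP a : superderivation_of_degree G a (hom a).
  apply: central_superderivation_of_degree => [b x xb|x|w Cw]; rewrite homE.
  - have other := part_proj_other xb.
    case: (Z2P b) xb other => -> xb; rewrite ?add0r ?Z2_addrr => ->;
      by rewrite !linear0 ?addr0 ?add0r part_projP.
  - by rewrite memvD ?gradedC.
  - by rewrite !D0 ?gradedC // !linear0 addr0.
exists (hom 0), (hom 1); split=> //; apply/lfunP => x.
rewrite add_lfunE !homE add0r addrACA part_proj_sum01 part_proj_sum.
by rewrite -linearD part_proj_sum01.
Qed.

End Central.
End LieSuperalgebra.

Theorem theorem3p2 (F : fieldType) (L : vectType F) (G : lieSuperalgebra L) :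
  2%N \notin [pchar F]%R ->
  step_nilpotent G 2 ->
  exists Delta : 'End(L), pure_local_superderivation G Delta.
Proof.
rewrite inE /= => two_neq0 [_ L2 L1].
pose C := bracketv G fullv fullv.
have bracketC x y : bracket G x y \in C by rewrite memv_bracket ?memvf.
(* [[L, C]] is [lower_central G 2], which is zero. *)
have centralC w x : w \in C -> bracket G x w = 0.
  by move=> Cw; apply/eqP; rewrite -memv0 -L2 memv_bracket ?memvf.
have gradedC a w : w \in C -> part_proj G a w \in C.
  exact: part_proj_bracketv.
have centralCl := central_bracketl centralC gradedC.
pose Delta := graded_proj G C.
have DeltaC x : Delta x \in C := graded_proj_mem _ _ _.
have DeltaK w : w \in C -> Delta w = w.
  by move=> Cw; apply: graded_proj_id => a; apply: gradedC.
have Delta_part a x : x \in part G a -> Delta x \in part G a.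
  exact: graded_proj_part.
exists Delta; split=> [x|[D0 [D1 [[D0part D0der] [D1part _] DeltaD]]]].
- have [Cx|Cx] := boolP (x \in C).
  (* [E] fixes every bracket, and as [Delta] has central values, [[E y, z]] and [[y, E z]] are both
     half of [[y, z]]. Characteristic not 2 allows the halving. *)
  + pose E : 'End(L) := 2%:R^-1 *: (\1%VF + Delta).
    have EE y : E y = 2%:R^-1 *: (y + Delta y).
      by rewrite scale_lfunE add_lfunE id_lfunE.
    have half y : 2%:R^-1 *: (y + y) = y :> L.
      by rewrite -mulr2n -scaler_nat scalerA mulVf ?scale1r.
    exists E; last by rewrite EE DeltaK // half.
    exists E, 0; split; last by rewrite addr0.
    * split=> [b y yb|b y z yb].
        by rewrite EE add0r memvZ // memvD ?Delta_part.
      rewrite !EE DeltaK // mul0n expr0 scale1r.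
      rewrite linearZl_LR linearZr_LR [bracket G (_ + _) z]linearDl /=.
      rewrite [bracket G y (_ + _)]linearDr /=.
      rewrite (centralCl _ z (DeltaC y)) (centralC _ y (DeltaC z)) !addr0.
      by rewrite -scalerDr.
    * split=> [b y _|b y z _]; rewrite !lfunE ?mem0v //=.
      by rewrite linear0l linear0r scaler0 addr0.
  + have vx0 : x - Delta x != 0.
      by rewrite subr_eq0; apply: contraNneq Cx => ->.
    have [g gx] := exists_endo_sending (Delta x) vx0.
    (* [1 - Delta] kills [C], and the outer [Delta] forces values into [C] while fixing
       [g (x - Delta x) = Delta x]. *)
    pose D : 'End(L) := (Delta \o g \o (\1 - Delta))%VF.
    have DE y : D y = Delta (g (y - Delta y)).
      by rewrite !comp_lfunE add_lfunE opp_lfunE id_lfunE.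
    exists D; last by rewrite DE gx (DeltaK _ (DeltaC x)).
    apply: (central_superderivation bracketC centralC gradedC) => [y|w Cw].
      by rewrite DE.
    by rewrite DE (DeltaK w Cw) subrr !linear0.
(* [Delta] and [D0] are even, so on part [b] the odd map [D1 = Delta - D0] has its values in both
   parts and vanishes. The degree 0 Leibniz rule thus holds for [Delta] itself. *)
- have D0E : D0 = Delta.
    apply/lfunP => y; elim/(part_ind (G := G)): y => [y z IHy IHz|b y yb].
      by rewrite !linearD /= IHy IHz.
    suff D1y0 : D1 y = 0 by rewrite DeltaD add_lfunE D1y0 addr0.
    apply: (@part_eq0 _ _ G b); last by rewrite addrC D1part.
    have -> : D1 y = Delta y - D0 y by rewrite DeltaD add_lfunE addrAC subrr add0r.
    by rewrite memvB ?Delta_part // -[b]add0r D0part.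
  apply: (L1 1%N) => //; apply/eqP; rewrite -subv0.
  apply/bracketvP => x y _ _; rewrite memv0; apply/eqP.
  elim/(part_ind (G := G)): x => [x1 x2 IH1 IH2|a x xa].
    by rewrite linearDl /= IH1 IH2 addr0.
  rewrite -(DeltaK _ (bracketC x y)) -D0E (D0der a) // D0E.
  by rewrite centralCl // centralC // scaler0 addr0.
Qed.
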